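(* Let $(X,\mathsf d)$ be a proper geodesic metric space, $\varphi:X\to\mathbb R$ a Kantorovich potential for the cost $\mathsf d^2/2$, and $\gamma\in G_\varphi$ a $\varphi$-Kantorovich geodesic of positive length $\ell:=\ell(\gamma)>0$. Define $$h(t,\epsilon)=2\big(\varphi_{t+\epsilon}(\gamma_t)-\varphi_t(\gamma_t)-\epsilon\,\ell^2/2\big),\qquad \bar h(t,\epsilon)=2\big(\bar\varphi_{t+\epsilon}(\gamma_t)-\varphi_t(\gamma_t)-\epsilon\,\ell^2/2\big).$$ Then for all $s<t$ and $\epsilon$ so that $s,t,s+\epsilon,t+\epsilon\in(0,1)$, we have (for both possibilities for $\pm$): $$\frac{h(t,\epsilon)-h(s,\epsilon)}{t-s}\ge\frac{s+\epsilon}{t+\epsilon}\big(\ell^\pm_{s+\epsilon}(\gamma_s)-\ell_s(\gamma_s)\big)^2,$$ and $$\frac{\bar h(t,\epsilon)-\bar h(s,\epsilon)}{t-s}\ge\frac{1-t-\epsilon}{1-s-\epsilon}\big(\bar\ell^\pm_{t+\epsilon}(\gamma_t)-\bar\ell_t(\gamma_t)\big)^2.$$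
   Context: A metric space is proper if closed balls are compact. $\mathrm{Geo}(X)=\{\gamma:[0,1]\to X:\mathsf d(\gamma_s,\gamma_t)=|s-t|\,\mathsf d(\gamma_0,\gamma_1)\}$, $\ell(\gamma)=\mathsf d(\gamma_0,\gamma_1)$. The $c$-transform ($c=\mathsf d^2/2$) of $\psi:X\to\mathbb R\cup\{\pm\infty\}$ is $\psi^c(x)=\inf_{y}\frac{\mathsf d(x,y)^2}2-\psi(y)$. A Kantorovich potential is a function $\varphi:X\to\mathbb R\cup\{-\infty\}$, not identically $-\infty$, with $\varphi=\psi^c$ for some $\psi$; then $\varphi,\varphi^c$ are finite everywhere. For $t\in(0,1)$, $-\varphi_t(x)=\inf_y\frac{\mathsf d(x,y)^2}{2t}-\varphi(y)$ and $\bar\varphi_t(x)=\inf_y\frac{\mathsf d(x,y)^2}{2(1-t)}-\varphi^c(y)$. $G_\varphi=\{\gamma\in\mathrm{Geo}(X):\varphi(\gamma_0)+\varphi^c(\gamma_1)=\ell(\gamma)^2/2\}$ is the set of $\varphi$-Kantorovich geodesics. (It is a fact that for $\gamma\in G_\varphi$, $t\in(0,1)$: $\varphi_t(\gamma_t)=\bar\varphi_t(\gamma_t)$ and $\partial_\tau|_{\tau=t}\varphi_\tau(\gamma_t)=\partial_\tau|_{\tau=t}\bar\varphi_\tau(\gamma_t)=\ell(\gamma)^2/2$.) For $f:X\to\mathbb R\cup\{+\infty\}$ and $t>0$, with $Q_tf(x)=\inf_y\frac{\mathsf d(x,y)^2}{2t}+f(y)$, set $D_f^+(x,t)=\sup\limsup_n\mathsf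 d(x,y_n)$ and $D_f^-(x,t)=\inf\liminf_n\mathsf d(x,y_n)$, where sup and inf run over all minimizing sequences $\{y_n\}$ in the definition of $Q_tf(x)$. For $(x,t)\in X\times(0,1)$, $\ell_t^\pm(x)=D^\pm_{-\varphi}(x,t)/t$ and $\bar\ell_t^\pm(x)=D^\pm_{-\varphi^c}(x,1-t)/(1-t)$. When $\ell_t^+(x)=\ell_t^-(x)$ (resp. $\bar\ell_t^+(x)=\bar\ell_t^-(x)$) the common value is denoted $\ell_t(x)$ (resp. $\bar\ell_t(x)$); at $x=\gamma_t$ with $\gamma\in G_\varphi$, $t\in(0,1)$, both are well defined and equal to $\ell(\gamma)$. *)

(* Defs.v *)
(* MathComp-Analysis *)
From mathcomp Require Import all_boot all_order all_algebra.
From mathcomp Require Import all_classical all_reals all_analysis.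

Set Implicit Arguments.
Unset Strict Implicit.
Unset Printing Implicit Defensive.

Import Order.TTheory GRing.Theory Num.Theory.
Import numFieldNormedType.Exports.

Local Open Scope classical_set_scope.
Local Open Scope ring_scope.

Section MetricSpaces.
Context {R : realType}.

(* The closed ball is the set {y | d(x, y) <= r}; the library's closed_ball is
   the closure of the open ball, which may be smaller. *)
Definition proper_space (X : metricType R) : Prop :=
  forall (x : X) (r : R), compact [set y | mdist x y <= r].

(* A curve [0,1] -> X is encoded as a function R -> X of which only the values
   on [0,1] matter. *)
Definition Geo (X : metricType R) : set (R -> X) :=
  [set g | forall s t : R, s \in `[0, 1] -> t \in `[0, 1] ->
     mdist (g s) (g t) = `|s - t| * mdist (g 0) (g 1)].

Definition len (X : metricType R) (g : R -> X) : R := mdist (g 0) (g 1).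

Definition geodesic_space (X : metricType R) : Prop :=
  forall x y : X, exists2 g : R -> X, Geo g & g 0 = x /\ g 1 = y.

End MetricSpaces.

Section Potentials.
Context {R : realType} {X : metricType R}.
Local Open Scope ereal_scope.

Implicit Types (phi f : X -> \bar R) (x : X) (s t e : R) (g : R -> X).

Definition c_transform (psi : X -> \bar R) (x : X) : \bar R :=
  ereal_inf [set (mdist x y ^+ 2 / 2)%:E - psi y | y in [set: X]].

Definition Kantorovich_potential phi : Prop :=
  [/\ forall x, phi x != +oo, exists x, phi x != -oo &
      exists psi : X -> \bar R, phi = c_transform psi].

Definition Kantorovich_geodesic phi : set (R -> X) :=
  [set g | Geo g /\
     phi (g 0%R) + c_transform phi (g 1%R) = (len g ^+ 2 / 2)%:E].

Definition hopf_lax f t x : \bar R :=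
  ereal_inf [set (mdist x y ^+ 2 / (2 * t))%:E + f y | y in [set: X]].

(* phi_t and \bar phi_t *)
Definition interp phi t x : \bar R := - hopf_lax (fun y => - phi y) t x.

Definition interpb phi t x : \bar R :=
  hopf_lax (fun y => - c_transform phi y) (1 - t) x.

Definition minimizing f x t : set (nat -> X) :=
  [set y | (fun n => (mdist x (y n) ^+ 2 / (2 * t))%:E + f (y n)) @ \oo
             --> hopf_lax f t x].

Definition Dplus f x t : \bar R :=
  ereal_sup [set limn_esup (fun n => (mdist x (y n))%:E)
            | y in minimizing f x t].

Definition Dminus f x t : \bar R :=
  ereal_inf [set limn_einf (fun n => (mdist x (y n))%:E)
            | y in minimizing f x t].

Definition ell_plus phi t x : \bar R := Dplus (fun y => - phi y) x t / t%:E.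

Definition ell_minus phi t x : \bar R := Dminus (fun y => - phi y) x t / t%:E.

Definition ellb_plus phi t x : \bar R :=
  Dplus (fun y => - c_transform phi y) x (1 - t) / (1 - t)%:E.

Definition ellb_minus phi t x : \bar R :=
  Dminus (fun y => - c_transform phi y) x (1 - t) / (1 - t)%:E.

(* The common value of ell_plus and ell_minus (resp. of their barred versions);
   the value +oo is a default for the case in which they differ. *)
Definition ell phi t x : \bar R :=
  if ell_plus phi t x == ell_minus phi t x then ell_plus phi t x else +oo.

Definition ellb phi t x : \bar R :=
  if ellb_plus phi t x == ellb_minus phi t x then ellb_plus phi t x else +oo.

Definition h phi g t e : \bar R :=
  2%:E * (interp phi (t + e) (g t) - interp phi t (g t)
          - (e * len g ^+ 2 / 2)%:E).

(* The subtracted term is phi_t, not \bar phi_t; they agree at g t when g is a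
   Kantorovich geodesic. *)
Definition hb phi g t e : \bar R :=
  2%:E * (interpb phi (t + e) (g t) - interp phi t (g t)
          - (e * len g ^+ 2 / 2)%:E).

End Potentials.

(* Main.v *)
(** Test the infimum defining Q_T f (g t), where T = t + e, with a minimizing
    sequence y_n of Q_S f (g s), where S = s + e.  Since
    d(g t, y_n) <= (t - s) l + d(g s, y_n), completing the square gives
      S / T (d(g s, y_n) / S - l)^2
        <= 2 (Q_S f (g s) - Q_T f (g t)) / (t - s) + l^2 + o(1),
    and the right-hand side is the difference quotient of h for f = - phi.
    For e = 0 it vanishes, because Q_t f (g t) = t l^2 / 2 + f (g 0) along a
    Kantorovich geodesic; hence l_t (g t) = l.  The barred inequality is the same
    statement for f = - phi^c along the reversed geodesic. *)
Require Import Defs.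
From mathcomp Require Import all_boot all_order all_algebra.
From mathcomp Require Import all_classical all_reals all_analysis.
From mathcomp Require Import ring lra.

Import Order.TTheory GRing.Theory Num.Theory.
Import numFieldNormedType.Exports.

Local Open Scope classical_set_scope.
Local Open Scope ring_scope.
Local Open Scope ereal_scope.

(** * Bounds passed to the limit *)

Lemma ler_norm_sqrt_addgt0 (R : rcfType) (b k : R) : (0 <= k)%R ->
  (forall d : R, (0 < d)%R -> (`|b| <= Num.sqrt (k + d))%R) -> (b ^+ 2 <= k)%R.
Proof.
move=> k0 bk; apply/ler_addgt0Pr => d d0.
have kd0 : (0 <= k + d)%R by rewrite addr_ge0// ltW.
by rewrite -real_normK ?num_real// -(sqr_sqrtr kd0) ler_sqr ?nnegrE ?sqrtr_ge0 ?bk.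
Qed.

(** [limn_esup] is an infimum of suprema over the sets of the filter, and the set of indices where
    the bounds hold is one of these sets. Applied to [- u], the same choice handles [limn_einf]. *)
Lemma limn_esup_einf_near {R : realType} (u : nat -> R) (a b : R) :
  (\forall n \near \oo, a <= u n <= b)%R ->
  a%:E <= limn_einf (EFin \o u) <= b%:E /\ a%:E <= limn_esup (EFin \o u) <= b%:E.
Proof.
move=> uab.
have ub : limn_esup (EFin \o u) <= b%:E.
  apply: ge_ereal_inf; exists (ereal_sup ((EFin \o u) @` [set n | (a <= u n <= b)%R])).
    by exists [set n | (a <= u n <= b)%R].
  by apply: ge_ereal_sup => _ [n /andP[_ unb] <-]; rewrite lee_fin.
have lb : a%:E <= limn_einf (EFin \o u).
  rewrite /limn_einf leeNr; apply: ge_ereal_inf.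
  exists (ereal_sup ((\- (EFin \o u)) @` [set n | (a <= u n <= b)%R])).
    by exists [set n | (a <= u n <= b)%R].
  by apply: ge_ereal_sup => _ [n /andP[aun _] <-] /=; rewrite lee_fin lerN2.
have lu := limn_einf_sup (EFin \o u).
by rewrite lb ub (le_trans lu ub) (le_trans lb lu).
Qed.

(** * Hopf-Lax semigroup and distances along minimizing sequences *)

Section HopfLax.
Context {R : realType} {X : metricType R}.
Implicit Types (f : X -> \bar R) (p q y z : X).

Lemma hopf_lax_le f t x y : hopf_lax f t x <= (mdist x y ^+ 2 / (2 * t))%:E + f y.
Proof. by apply: ereal_inf_lbound; exists y. Qed.

(** Needed because [Dplus] and [Dminus] are a supremum and an infimum over minimizing sequences,
    with junk values if there were none. *)
Lemma minimizing_neq0 f x t : minimizing f x t !=set0.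
Proof.
have [|u uS ul] := ereal_inf_seq (S := [set (mdist x y ^+ 2 / (2 * t))%:E + f y | y in [set: X]]).
  by apply/set0P; exists ((mdist x x ^+ 2 / (2 * t))%:E + f x), x.
have /choice[y yu] : forall n, exists y, (mdist x y ^+ 2 / (2 * t))%:E + f y = u n.
  by move=> n; have [y _ <-] := uS n; exists y.
by exists y; rewrite /minimizing /= (funext yu).
Qed.

(** By convexity of the square, [(k + d)^2 / 2] is at most [d^2 / (2 t) + k^2 / (2 (1 - t))]; the
    defect is an explicit square. With the triangle inequality through [x] this bounds every
    competitor. *)
Lemma hopf_lax_ge f z (c t : R) x : (0 < t < 1)%R ->
  (forall y, (c - mdist z y ^+ 2 / 2)%:E <= f y) ->
  (c - mdist x z ^+ 2 / (2 * (1 - t)))%:E <= hopf_lax f t x.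
Proof.
move=> /andP[t0 t1] fz; apply: le_ereal_inf_tmp => _ [y _ <-].
apply: (@le_trans _ _ ((mdist x y ^+ 2 / (2 * t))%:E + (c - mdist z y ^+ 2 / 2)%:E));
  last exact: leeD2l.
rewrite -EFinD lee_fin.
have := metric_triangle z x y; rewrite (metric_sym z x).
have := mdist_ge0 z y; have := mdist_ge0 x z; have := mdist_ge0 x y.
move: (mdist z y) (mdist x z) (mdist x y) => m k d d0 k0 m0 mkd.
have m2 : (m ^+ 2 <= (k + d) ^+ 2)%R by nra.
have t1' : (1 - t != 0)%R by rewrite subr_eq0 gt_eqF.
have -> : (d ^+ 2 / (2 * t) = (k + d) ^+ 2 / 2 - k ^+ 2 / (2 * (1 - t))
    + ((1 - t) * d - t * k) ^+ 2 / (2 * t * (1 - t)))%R.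
  by field; rewrite t1' gt_eqF.
have : (0 <= ((1 - t) * d - t * k) ^+ 2 / (2 * t * (1 - t)))%R.
  by rewrite divr_ge0 ?sqr_ge0// !mulr_ge0// ?subr_ge0 ltW.
lra.
Qed.

Lemma hopf_lax_fin f z y0 (c F t : R) x : (0 < t < 1)%R ->
  (forall y, (c - mdist z y ^+ 2 / 2)%:E <= f y) -> f y0 = F%:E ->
  exists A, hopf_lax f t x = A%:E.
Proof.
move=> t01 fz fy0; have := hopf_lax_ge _ _ _ _ x t01 fz.
have := hopf_lax_le f t x y0; rewrite fy0.
by case: hopf_lax => [A||]//; exists A.
Qed.

Lemma minimizing_dist f p q (S a l A B : R) (y : nat -> X) (d : R) :
  (0 < S)%R -> (0 < a)%R -> (mdist q p <= a * l)%R ->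
  hopf_lax f S p = A%:E -> hopf_lax f (S + a) q = B%:E ->
  minimizing f p S y -> (0 < d)%R ->
  \forall n \near \oo, (S / (S + a) * (mdist p (y n) / S - l) ^+ 2
                        <= 2 * (A - B) / a + l ^+ 2 + d)%R.
Proof.
move=> S0 a0 qp fA fB; rewrite /minimizing /= fA => yA d0.
(* The tolerance [a * d / 2] turns into [d] after the final multiplication by [2 / a]. *)
have /yA : nbhs A%:E [set z | z < (A + a * d / 2)%:E].
  apply: (nbhs_open_ereal_lt (r := A) (f := fun r => r + a * d / 2)%R).
  by rewrite ltrDl divr_gt0// mulr_gt0.
rewrite nbhs_filterE /= => yA'.
apply: filterS yA' => n /=; have := hopf_lax_le f (S + a) q (y n); rewrite fB.
(* [f (y n)] is finite: [+oo] contradicts near-minimality, [-oo] contradicts the finiteness of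
   [B]. *)
case: (f (y n)) => [r||]//; rewrite -!EFinD lee_fin lte_fin.
have := metric_triangle q p (y n).
have := mdist_ge0 p (y n); have := mdist_ge0 q (y n); have := mdist_ge0 q p.
move: qp; move: (mdist q p) (mdist q (y n)) (mdist p (y n)) => m k e.
move=> mal m0 k0 e0 kme.
have Sa0 : (0 < S + a)%R by rewrite addr_gt0.
have k2 : (k ^+ 2 / (2 * (S + a)) <= (a * l + e) ^+ 2 / (2 * (S + a)))%R.
  rewrite ler_pM2r ?invr_gt0 ?mulr_gt0//; nra.
have E : ((a * l + e) ^+ 2 / (2 * (S + a)) = e ^+ 2 / (2 * S) + a * l ^+ 2 / 2
   - a / 2 * (S / (S + a) * (e / S - l) ^+ 2))%R.
  by field; rewrite !gt_eqF.
rewrite {}E in k2.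
move: (S / (S + a) * _)%R k2 => G k2 Br eA.
suff : (G <= (2 * (A - B) + a * l ^+ 2 + a * d) / a)%R.
  by move/le_trans; apply; rewrite le_eqVlt; apply/orP; left; apply/eqP; field; rewrite gt_eqF.
rewrite ler_pdivlMr//; lra.
Qed.

Lemma Dminus_Dplus_between f x t (a b : R) :
  (forall y : nat -> X, minimizing f x t y -> \forall n \near \oo, (a <= mdist x (y n) <= b)%R) ->
  a%:E <= Dminus f x t <= b%:E /\ a%:E <= Dplus f x t <= b%:E.
Proof.
move=> ab; have {}ab (y : nat -> X) : minimizing f x t y ->
    let u := (fun n => mdist x (y n))%R in
    a%:E <= limn_einf (EFin \o u) <= b%:E /\ a%:E <= limn_esup (EFin \o u) <= b%:E.
  by move=> /ab; exact: limn_esup_einf_near.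
have [y0 my0] := minimizing_neq0 f x t.
have [/andP[ai ib] /andP[as' sb]] := ab _ my0.
split; apply/andP; split.
- by apply: le_ereal_inf_tmp => _ [y my <-]; have [/andP[]] := ab _ my.
- by apply: ge_ereal_inf; eexists; [exists y0; [exact: my0|reflexivity]|].
- by apply: le_ereal_sup_tmp; eexists; [exists y0; [exact: my0|reflexivity]|].
- by apply: ge_ereal_sup => _ [y my <-]; have [_ /andP[]] := ab _ my.
Qed.

(** The bounds for [d = 1] already force [D] to be finite; letting [d] tend to 0 then removes the
    slack. *)
Lemma sqr_speed_le (D : \bar R) (S l k : R) : (0 < S)%R -> (0 <= k)%R ->
  (forall d : R, (0 < d)%R ->
    (S * (l - Num.sqrt (k + d)))%:E <= D <= (S * (l + Num.sqrt (k + d)))%:E) ->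
  exists2 D' : R, D = D'%:E & ((D' / S - l) ^+ 2 <= k)%R.
Proof.
move=> S0 k0 H; have := H 1%R ltr01.
case: D H => [D'||] H; rewrite ?leeNy_eq ?leye_eq ?andbF// => _; exists D' => //.
apply: ler_norm_sqrt_addgt0 => // d d0; have := H d d0; rewrite !lee_fin.
by rewrite ler_distl ler_pdivlMr// ler_pdivrMr// ![(_ * S)%R]mulrC.
Qed.

Lemma Dplus_Dminus_speed f p q (S a l A B : R) :
  (0 < S)%R -> (0 < a)%R -> (mdist q p <= a * l)%R ->
  hopf_lax f S p = A%:E -> hopf_lax f (S + a) q = B%:E ->
  (exists2 D : R, Dplus f p S = D%:E &
    (S / (S + a) * (D / S - l) ^+ 2 <= 2 * (A - B) / a + l ^+ 2)%R) /\
  (exists2 D : R, Dminus f p S = D%:E &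
    (S / (S + a) * (D / S - l) ^+ 2 <= 2 * (A - B) / a + l ^+ 2)%R).
Proof.
move=> S0 a0 qp fA fB.
have H := minimizing_dist f p q S a l A B _ _ S0 a0 qp fA fB.
move: (2 * (A - B) / a + l ^+ 2)%R H => K H.
have c0 : (0 < S / (S + a))%R by rewrite divr_gt0// addr_gt0.
move: (S / (S + a))%R c0 H => c c0 H.
(* Some minimizing sequence exists, and along it a nonnegative quantity is eventually at most
   [K + d]. The sign matters because [Num.sqrt] is 0 on negative reals. *)
have K0 : (0 <= K)%R.
  apply/ler_addgt0Pr => d d0; have [y my] := minimizing_neq0 f p S.
  have [n] := filter_ex (H _ _ my d0); apply: le_trans.
  by rewrite mulr_ge0 ?sqr_ge0// ltW.
have [M P] : (forall d : R, (0 < d)%R ->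
    (S * (l - Num.sqrt (K / c + d)))%:E <= Dminus f p S
      <= (S * (l + Num.sqrt (K / c + d)))%:E) /\
    (forall d : R, (0 < d)%R ->
    (S * (l - Num.sqrt (K / c + d)))%:E <= Dplus f p S
      <= (S * (l + Num.sqrt (K / c + d)))%:E).
  suff MP (d : R) : (0 < d)%R ->
      (S * (l - Num.sqrt (K / c + d)))%:E <= Dminus f p S
        <= (S * (l + Num.sqrt (K / c + d)))%:E /\
      (S * (l - Num.sqrt (K / c + d)))%:E <= Dplus f p S
        <= (S * (l + Num.sqrt (K / c + d)))%:E.
    by split=> d /MP[].
  move=> d0.
  apply: Dminus_Dplus_between => y my.
  (* Slack [c * d] becomes [d] after division by [c]. *)
  have cd0 : (0 < c * d)%R by rewrite mulr_gt0.
  apply: filterS (H _ _ my cd0) => n.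
  rewrite mulrC -ler_pdivlMr// mulrDl mulrAC divff ?gt_eqF// mul1r => yn.
  have : (`|mdist p (y n) / S - l| <= Num.sqrt (K / c + d))%R.
    by rewrite -sqrtr_sqr ler_wsqrtr.
  rewrite ler_distl ler_pdivlMr// ler_pdivrMr//.
  by rewrite ![(_ * S)%R]mulrC.
have Kc0 : (0 <= K / c)%R by rewrite divr_ge0// ltW.
have [D -> D1] := sqr_speed_le _ _ _ _ S0 Kc0 P.
have [D' -> D2] := sqr_speed_le _ _ _ _ S0 Kc0 M.
by split; [exists D|exists D'] => //; rewrite mulrC -ler_pdivlMr.
Qed.

End HopfLax.

(** * Hopf-Lax values and speeds along a geodesic *)

Section Geodesic.
Context {R : realType} {X : metricType R}.
Variables (f : X -> \bar R) (g : R -> X) (F : R).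
Hypothesis gG : Geo g.
(** Together with the next hypothesis: [g 0] minimizes [f y + d(g 1, y)^2 / 2]. This is the common
    form of [- phi] along [g] and of [- phi^c] along the reversed curve. *)
Hypothesis f0 : f (g 0%R) = F%:E.
Hypothesis f1 : forall y, (F + len g ^+ 2 / 2 - mdist (g 1%R) y ^+ 2 / 2)%:E <= f y.

Lemma Geo_mdist (s t : R) : (0 <= s <= 1)%R -> (0 <= t <= 1)%R ->
  mdist (g s) (g t) = (`|s - t| * len g)%R.
Proof. by move=> s01 t01; rewrite gG// in_itv. Qed.

(** The competitor [g 0] gives the upper bound, and [hopf_lax_ge] with [z = g 1] the matching lower
    bound. *)
Lemma hopf_lax_geodesic (t : R) : (0 < t < 1)%R ->
  hopf_lax f t (g t) = (t * len g ^+ 2 / 2 + F)%:E.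
Proof.
move=> t01; have /andP[t0 t1] := t01.
have t01' : (0 <= t <= 1)%R by rewrite !ltW.
apply/eqP; rewrite eq_le; apply/andP; split.
  have := hopf_lax_le f t (g t) (g 0%R); rewrite f0 -EFinD Geo_mdist ?lexx ?ler01//.
  rewrite subr0 gtr0_norm//; congr (_ <= _%:E); congr (_ + _)%R.
  by field; rewrite gt_eqF.
have := hopf_lax_ge _ _ _ _ (g t) t01 f1.
rewrite Geo_mdist ?lexx ?ler01// distrC gtr0_norm ?subr_gt0//.
congr (_%:E <= _); field.
by rewrite subr_eq0 gt_eqF.
Qed.

(** The Hopf-Lax times [S], [T] are decoupled from the curve parameters [s], [t], only the
    increments agreeing; this makes room for the shift by [e]. *)
Lemma hopf_lax_geodesic_speed (s t S T : R) : (0 < s)%R -> (s < t)%R -> (t < 1)%R ->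
  (0 < S)%R -> (T < 1)%R -> (T - S = t - s)%R -> exists A B : R,
  [/\ hopf_lax f S (g s) = A%:E, hopf_lax f T (g t) = B%:E,
    exists2 D : R, Dplus f (g s) S = D%:E &
    (S / T * (D / S - len g) ^+ 2 <= 2 * (A - B) / (t - s) + len g ^+ 2)%R &
    exists2 D : R, Dminus f (g s) S = D%:E &
    (S / T * (D / S - len g) ^+ 2 <= 2 * (A - B) / (t - s) + len g ^+ 2)%R].
Proof.
move=> s0 st t1 S0 T1 TS; have ET : T = (S + (t - s))%R by rewrite -TS addrC subrK.
have S01 : (0 < S < 1)%R by lra.
have T01 : (0 < T < 1)%R by lra.
have [A SA] := hopf_lax_fin _ _ _ _ _ _ (g s) S01 f1 f0.
have [B TB] := hopf_lax_fin _ _ _ _ _ _ (g t) T01 f1 f0.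
exists A, B; have ts0 : (0 < t - s)%R by rewrite subr_gt0.
have gts : (mdist (g t) (g s) <= (t - s) * len g)%R.
  by rewrite Geo_mdist ?gtr0_norm//; lra.
rewrite ET in TB *.
have [DP DM] := Dplus_Dminus_speed _ _ _ _ _ _ _ _ S0 ts0 gts SA TB.
by split.
Qed.

Lemma Dplus_Dminus_geodesic (t : R) : (0 < t < 1)%R ->
  Dplus f (g t) t = (t * len g)%:E /\ Dminus f (g t) t = (t * len g)%:E.
Proof.
(* Any later time below 1 would do: Hopf-Lax values are affine along [g] with slope
   [len g ^+ 2 / 2], so the bound on the squared speed defect is 0. *)
move=> t01; pose t' : R := ((t + 1) / 2)%R.
have [tt' t'1] : (t < t' /\ t' < 1)%R by rewrite /t'; split; lra.
have t0 : (0 < t)%R by lra.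
have t'01 : (0 < t' < 1)%R by lra.
have [A [B []]] := hopf_lax_geodesic_speed t t' t t' t0 tt' t'1 t0 t'1 erefl.
rewrite !hopf_lax_geodesic// => -[<-] [<-].
have -> : (2 * (t * len g ^+ 2 / 2 + F - (t' * len g ^+ 2 / 2 + F)) / (t' - t)
  + len g ^+ 2 = 0)%R by field; rewrite subr_eq0 gt_eqF.
suff H (D : R) : (t / t' * (D / t - len g) ^+ 2 <= 0)%R -> D = (t * len g)%R.
  by move=> [D -> /H ->] [D' -> /H ->].
rewrite pmulr_rle0 ?divr_gt0//; last lra.
move=> D0; have /eqP : ((D / t - len g) ^+ 2 = 0)%R.
  by apply/eqP; rewrite eq_le D0 sqr_ge0.
rewrite sqrf_eq0 subr_eq0 => /eqP <-.
by rewrite mulrC divfK// gt_eqF.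
Qed.

End Geodesic.

(** * Time reversal of geodesics *)

Section Reversal.
Context {R : realType} {X : metricType R}.
Variable g : R -> X.

Lemma Geo_rev : Geo g -> Geo (fun r => g (1 - r)%R).
Proof.
move=> gG s t; rewrite !in_itv /= => s01 t01.
rewrite gG ?in_itv /=; [|lra|lra].
rewrite subr0 subrr (metric_sym (g 1%R)); congr (_ * _)%R.
by rewrite opprB addrC addrA subrK distrC.
Qed.

Lemma len_rev : len (fun r => g (1 - r)%R) = len g.
Proof. by rewrite /len subr0 subrr metric_sym. Qed.

End Reversal.

(** * Kantorovich duality supplies the hypotheses on [f] *)

Section Potential.
Context {R : realType} {X : metricType R}.
Variables (phi : X -> R) (g : R -> X).
Hypothesis gphi : Kantorovich_geodesic (EFin \o phi) g.

Let Phi : X -> \bar R := EFin \o phi.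

Lemma c_transform_le x y : c_transform Phi x <= (mdist x y ^+ 2 / 2 - phi y)%:E.
Proof. by apply: ereal_inf_lbound; exists y. Qed.

Lemma c_transform_geodesic :
  c_transform Phi (g 1%R) = (len g ^+ 2 / 2 - phi (g 0%R))%:E.
Proof.
case: gphi => _; case: (c_transform _ _) => //= r [<-].
by rewrite addrAC subrr add0r.
Qed.

Lemma oppe_potential_ge y :
  (- phi (g 0) + len g ^+ 2 / 2 - mdist (g 1) y ^+ 2 / 2)%:E <= - Phi y.
Proof.
have := c_transform_le (g 1%R) y; rewrite c_transform_geodesic !lee_fin; lra.
Qed.

Lemma oppe_c_transform_rev0 :
  - c_transform Phi (g (1 - 0)) = (phi (g 0) - len g ^+ 2 / 2)%:E.
Proof. by rewrite subr0 c_transform_geodesic -EFinN opprB. Qed.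

(** The first three terms add up to [phi (g 0)], so testing the infimum in [c_transform Phi y] at
    [g 0] is enough. *)
Lemma oppe_c_transform_rev_ge y :
  (phi (g 0) - len g ^+ 2 / 2 + len (fun r => g (1 - r)) ^+ 2 / 2
    - mdist (g (1 - 1)) y ^+ 2 / 2)%:E <= - c_transform Phi y.
Proof.
rewrite len_rev subrr leeNr; apply: le_trans (c_transform_le _ (g 0%R)) _.
rewrite metric_sym lee_fin; lra.
Qed.

End Potential.

(** * Speeds at points of Kantorovich geodesics, and the two inequalities *)

Lemma EFin_div (R : realType) (x y : R) : (0 < y)%R -> x%:E / y%:E = (x / y)%:E.
Proof. by move=> y0; rewrite inver gt_eqF. Qed.

Lemma ell_geodesic (R : realType) (X : metricType R) (phi : X -> R) (g : R -> X) (t : R) :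
  Kantorovich_geodesic (EFin \o phi) g -> (0 < t < 1)%R ->
  ell (EFin \o phi) t (g t) = (len g)%:E.
Proof.
move=> gphi t01; have /andP[t0 _] := t01.
have [DP DM] := Dplus_Dminus_geodesic _ _ _ gphi.1 erefl (oppe_potential_ge _ _ gphi) _ t01.
rewrite /ell /ell_plus /ell_minus DP DM eqxx EFin_div//.
by rewrite mulrAC divff ?mul1r// gt_eqF.
Qed.

Lemma ellb_geodesic (R : realType) (X : metricType R) (phi : X -> R) (g : R -> X) (t : R) :
  Kantorovich_geodesic (EFin \o phi) g -> (0 < t < 1)%R ->
  ellb (EFin \o phi) t (g t) = (len g)%:E.
Proof.
move=> gphi t01; have /andP[_ t1] := t01.
have t01' : (0 < 1 - t < 1)%R by lra.
have := Dplus_Dminus_geodesic _ _ _ (Geo_rev _ gphi.1)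
  (oppe_c_transform_rev0 _ _ gphi) (oppe_c_transform_rev_ge phi g) _ t01'.
rewrite len_rev subKr => -[DP DM].
rewrite /ellb /ellb_plus /ellb_minus DP DM eqxx EFin_div; last by lra.
by rewrite mulrAC divff ?mul1r// gt_eqF//; lra.
Qed.

Theorem theorem5p2 (R : realType) (X : metricType R)
    (Xproper : proper_space X) (Xgeodesic : geodesic_space X)
    (phi : X -> R) (phiK : Kantorovich_potential (EFin \o phi))
    (g : R -> X) (gphi : Kantorovich_geodesic (EFin \o phi) g)
    (g_pos : (0 < len g)%R)
    (s t e : R) (st : (s < t)%R)
    (s01 : (0 < s < 1)%R) (t01 : (0 < t < 1)%R)
    (se01 : (0 < s + e < 1)%R) (te01 : (0 < t + e < 1)%R) :
  let Phi : X -> \bar R := EFin \o phi in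
  [/\ ((s + e) / (t + e))%:E *
        (ell_plus Phi (s + e) (g s) - ell Phi s (g s)) ^+ 2
      <= (h Phi g t e - h Phi g s e) / (t - s)%:E,
      ((s + e) / (t + e))%:E *
        (ell_minus Phi (s + e) (g s) - ell Phi s (g s)) ^+ 2
      <= (h Phi g t e - h Phi g s e) / (t - s)%:E,
      ((1 - t - e) / (1 - s - e))%:E *
        (ellb_plus Phi (t + e) (g t) - ellb Phi t (g t)) ^+ 2
      <= (hb Phi g t e - hb Phi g s e) / (t - s)%:E &
      ((1 - t - e) / (1 - s - e))%:E *
        (ellb_minus Phi (t + e) (g t) - ellb Phi t (g t)) ^+ 2
      <= (hb Phi g t e - hb Phi g s e) / (t - s)%:E].
Proof.
move=> Phi.
rewrite (ell_geodesic _ _ _ _ _ gphi s01) (ellb_geodesic _ _ _ _ _ gphi t01).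
have ts0 : (0 < t - s)%R by rewrite subr_gt0.
have interp_geodesic r : (0 < r < 1)%R ->
    interp Phi r (g r) = (phi (g 0) - r * len g ^+ 2 / 2)%:E.
  move=> r01; rewrite /interp.
  rewrite (hopf_lax_geodesic _ _ _ gphi.1 erefl (oppe_potential_ge _ _ gphi))//.
  by rewrite -EFinN opprD opprK addrC.
have [s0 s1 t0 t1] : [/\ 0 < s, s < 1, 0 < t & t < 1]%R by split; lra.
have [S0 S1 T0 T1] : [/\ 0 < s + e, s + e < 1, 0 < t + e & t + e < 1]%R by split; lra.
have [|A [B [hA hB [D hD P] [D' hD' M]]]] := hopf_lax_geodesic_speed _ _ _ gphi.1 erefl
    (oppe_potential_ge _ _ gphi) _ _ _ _ s0 st t1 S0 T1; first lra.
(* The terms linear in [e] cancel, and [phi_r (g r)], affine in [r] with slope [- len g ^+ 2 / 2],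
   contributes the summand [len g ^+ 2]. *)
have hE : (h Phi g t e - h Phi g s e) / (t - s)%:E
    = (2 * (A - B) / (t - s) + len g ^+ 2)%:E.
  rewrite /h !interp_geodesic// /interp hA hB -!EFinN -!EFinB EFin_div//.
  by congr (_%:E); field; rewrite subr_eq0 gt_eqF.
(* Reversal exchanges the endpoints: the curve now passes [g t] first, at time [1 - t], so the speed
   is estimated at [g t] and [A'] is the value there. *)
have st' : (1 - t < 1 - s)%R by lra.
have [] := hopf_lax_geodesic_speed _ _ _ (Geo_rev _ gphi.1)
    (oppe_c_transform_rev0 _ _ gphi) (oppe_c_transform_rev_ge phi g)
    (1 - t)%R (1 - s)%R (1 - (t + e))%R (1 - (s + e))%R; try lra.
move=> A' [B']; rewrite len_rev !subKr => -[hA' hB' [Db hDb Pb] [Db' hDb' Mb]].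
have hbE : (hb Phi g t e - hb Phi g s e) / (t - s)%:E
    = (2 * (A' - B') / (t - s) + len g ^+ 2)%:E.
  rewrite /hb !interp_geodesic// /interpb hA' hB' -!EFinB EFin_div//.
  by congr (_%:E); field; rewrite subr_eq0 gt_eqF.
have ts' : (1 - s - (1 - t) = t - s)%R by lra.
rewrite {}ts' in Pb Mb.
rewrite hE hbE /ell_plus /ell_minus /ellb_plus /ellb_minus hD hD' hDb hDb'.
have Sb0 : (0 < 1 - (t + e))%R by lra.
by rewrite -!addrA -!opprD !EFin_div.
Qed.
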